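(* Let $\mathrm L$ be a compact logic such that $\mathrm{FL}\leq\mathrm L\leq\mathrm{CL}$. Write ${-}x:=x\backslash 0$ and ${\sim}x:=0/x$. Then the following are equivalent: (1) for all $\Gamma$ and $\varphi$: $\Gamma\vdash_{\mathrm{CL}}\varphi\iff\Gamma\vdash_{\mathrm L}{-}{-}\varphi$; (2) for all $\Gamma$ and $\varphi$: $\Gamma\vdash_{\mathrm{CL}}\varphi\iff\Gamma\vdash_{\mathrm L}{\sim}{\sim}\varphi$; (3) for all $\Gamma$ and $\varphi$: $\Gamma\vdash_{\mathrm{CL}}{-}\varphi\iff\Gamma\vdash_{\mathrm L}{-}\varphi$; (4) for all $\Gamma$ and $\varphi$: $\Gamma\vdash_{\mathrm{CL}}{\sim}\varphi\iff\Gamma\vdash_{\mathrm L}{\sim}\varphi$; (5) for all $\Gamma$ and $\varphi$: $\Gamma,\varphi\vdash_{\mathrm L}0\iff\Gamma\vdash_{\mathrm L}{-}\varphi$; and ${-}(p\wedge{-}q)\vdash_{\mathrm L}{-}{-}(p\backslash q)$; (6) for all $\Gamma$ and $\varphi$: $\Gamma,\varphi\vdash_{\mathrm L}0\iff\Gamma\vdash_{\mathrm L}{\sim}\varphi$; and ${\sim}(p\wedge{\sim}q)\vdash_{\mathrm L}{\sim}{\sim}(q/p)$.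
   Context: An $\mathrm{FL}$-algebra is an algebra $\langle A,\wedge,\vee,\top,\bot,\cdot,1,\backslash,/,0\rangle$ such that $\langle A,\wedge,\vee,\top,\bot\rangle$ is a bounded lattice with top $\top$ and bottom $\bot$, $\langle A,\cdot,1\rangle$ is a monoid, $x\leq z/y\iff x\cdot y\leq z\iff y\leq x\backslash z$, and $0$ is an arbitrary constant. A logic in this signature, over a fixed infinite set of variables, is a relation $\Gamma\vdash\varphi$ between sets of formulas and formulas which is reflexive, monotone, closed under cut and structural (closed under substitutions). The Full Lambek calculus $\mathrm{FL}$ is the logic with $\Gamma\vdash_{\mathrm{FL}}\varphi$ iff for every $\mathrm{FL}$-algebra $\mathbf A$ and every homomorphism $h$ from the formula algebra to $\mathbf A$, if $1\leq h(\gamma)$ for all $\gamma\in\Gamma$ then $1\leq h(\varphi)$. $\mathrm{CL}$ is classical logic in this signature, i.e. the consequence relation of truth preservation over the two-element Boolean algebra with $\cdot$ interpreted as $\wedge$, $1$ as $\top$, $0$ as $\bot$, and both $x\backslash y$ and $y/x$ as the classical implication $x\rightarrow y$. $\mathrm L_1\leq\mathrm L_2$ means that $\Gamma\vdash_{\mathrm L_1}\varphi$ implies $\Gamma\vdash_{\mathrm L_2}\varphi$ for all $\Gamma,\varphi$. A logic $\mathrm L$ is compact if whenever $\Gamma\vdash_{\mathrm L}\psi$ for all formulas $\psi$, there is a finite $\Gamma'\subseteq\Gamma$ with $\Gamma'\vdash_{\mathrm L}\psi$ for all formulas $\psi$. Here $p,q$ are distinct variables. *)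

(* Defs.v *)
From HB Require Import structures.
From mathcomp Require Import all_boot order.
From mathcomp Require Import classical_sets cardinality.

Set Implicit Arguments.
Unset Strict Implicit.
Unset Printing Implicit Defensive.

Local Open Scope classical_set_scope.
Local Open Scope order_scope.

(* [ldiv x z] is x \ z and [rdiv z y] is z / y. *)
HB.mixin Record isResiduated (d : Order.disp_t) A
    of Order.TBLattice d A & monoid.Monoid A := {
  ldiv : A -> A -> A;
  rdiv : A -> A -> A;
  fl0 : A;
  le_rdiv : forall x y z : A, (x <= rdiv z y) = ((x * y)%g <= z);
  le_ldiv : forall x y z : A, (y <= ldiv x z) = ((x * y)%g <= z)
}.

#[short(type="flAlgType")]
HB.structure Definition FLAlgebra (d : Order.disp_t) :=
  { A of isResiduated d A & Order.TBLattice d A & monoid.Monoid A }.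

HB.instance Definition _ := monoid.isMonoid.Build bool andbA andTb andbT.

Lemma bool_le_rdiv (x y z : bool) : (x <= (y ==> z)) = ((x * y)%g <= z).
Proof. by case: x; case: y; case: z. Qed.

Lemma bool_le_ldiv (x y z : bool) : (y <= (x ==> z)) = ((x * y)%g <= z).
Proof. by case: x; case: y; case: z. Qed.

(* The lattice part is the order false < true of the library. *)
HB.instance Definition _ := isResiduated.Build _ bool
  (ldiv := implb) (rdiv := fun z y => y ==> z) false
  bool_le_rdiv bool_le_ldiv.

Inductive form (V : Type) : Type :=
| Var of V
| Meet of form V & form V
| Join of form V & form V
| Top
| Bot
| Mul of form V & form V
| One
| Ldiv of form V & form V (* Ldiv x y is x \ y *)
| Rdiv of form V & form V (* Rdiv x y is x / y *)
| Zero.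
Arguments Top {V}.
Arguments Bot {V}.
Arguments One {V}.
Arguments Zero {V}.

Definition lneg (V : Type) (x : form V) : form V := Ldiv x Zero.
Definition rneg (V : Type) (x : form V) : form V := Rdiv Zero x.

Fixpoint subst (V : Type) (s : V -> form V) (x : form V) : form V :=
  match x with
  | Var v => s v
  | Meet a b => Meet (subst s a) (subst s b)
  | Join a b => Join (subst s a) (subst s b)
  | Top => Top
  | Bot => Bot
  | Mul a b => Mul (subst s a) (subst s b)
  | One => One
  | Ldiv a b => Ldiv (subst s a) (subst s b)
  | Rdiv a b => Rdiv (subst s a) (subst s b)
  | Zero => Zero
  end.

Record is_hom (V : Type) (d : Order.disp_t) (A : flAlgType d)
    (h : form V -> A) : Prop := IsHom {
  hom_meet : {morph h : x y / Meet x y >-> Order.meet x y};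
  hom_join : {morph h : x y / Join x y >-> Order.join x y};
  hom_top : h Top = \top;
  hom_bot : h Bot = \bot;
  hom_mul : {morph h : x y / Mul x y >-> (x * y)%g};
  hom_one : h One = 1%g;
  hom_ldiv : {morph h : x y / Ldiv x y >-> ldiv x y};
  hom_rdiv : {morph h : x y / Rdiv x y >-> rdiv x y};
  hom_zero : h Zero = fl0
}.

Definition consequence (V : Type) := set (form V) -> form V -> Prop.

Record is_logic (V : Type) (L : consequence V) : Prop := IsLogic {
  logic_refl : forall (G : set (form V)) x, G x -> L G x;
  logic_mono : forall (G D : set (form V)) x, G `<=` D -> L G x -> L D x;
  logic_cut : forall (G D : set (form V)) x,
    (forall y, D y -> L G y) -> L (G `|` D) x -> L G x;
  logic_struct : forall (s : V -> form V) (G : set (form V)) x,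
    L G x -> L (subst s @` G) (subst s x)
}.

Definition FL (V : Type) : consequence V := fun G x =>
  forall (d : Order.disp_t) (A : flAlgType d) (h : form V -> A), is_hom h ->
    (forall g, G g -> 1%g <= h g) -> 1%g <= h x.

Definition CL (V : Type) : consequence V := fun G x =>
  forall h : form V -> bool, is_hom h ->
    (forall g, G g -> h g = true) -> h x = true.

Definition logic_le (V : Type) (L1 L2 : consequence V) : Prop :=
  forall G x, L1 G x -> L2 G x.

(* Compactness in the weak sense: it only concerns inconsistent sets. *)
Definition compact_logic (V : Type) (L : consequence V) : Prop :=
  forall G : set (form V), (forall x, L G x) ->
    exists G' : set (form V),
      [/\ finite_set G', G' `<=` G & forall x, L G' x].

(* Main.v *)
(* By residuation x \ 0 and 0 / x are both above 1 exactly when x <= 0, so -x and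
   ~x are interderivable; this makes the left and the right versions equivalent.
   The hard direction goes from the deduction theorem for 0 together with
   -(p /\ -q) |- --(p \ q) to the Glivenko property.  If G does not prove --x,
   then G, -x does not prove 0 and extends to a set M maximal among those not
   proving 0.  Exactly one of y and -y is in M, for every y.  Hence if y is not in
   M or z is in M, then -(y /\ -z), so --(y \ z), so y \ z is in M.  Taking z to
   be bottom, every y outside M is "below bottom" according to M, which handles
   products.  So M is the truth set of a Boolean valuation refuting x. *)

Require Import Defs.
From mathcomp Require Import all_boot order.
From mathcomp Require Import boolp classical_sets cardinality.

Set Implicit Arguments.
Unset Strict Implicit.
Unset Printing Implicit Defensive.

Import Order.Theory.
Local Open Scope order_scope.
Local Open Scope classical_set_scope.

(** Induct on an enumeration of [A]: of two chain members only the larger is kept. The first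
    alternative covers the empty chain. *)
Lemma finite_sub_chain (T : Type) (F : set (set T)) (G A : set T) :
  total_on F subset -> finite_set A -> A `<=` G `|` \bigcup_(X in F) X ->
  A `<=` G \/ exists2 X, F X & A `<=` G `|` X.
Proof.
move=> totF finA AF.
(* [{classic T}] supplies the decidable equality that sequences need. *)
have /finite_seqP[s As] : finite_set (A : set {classic T}) by [].
have {AF} : [set` s] `<=` (G `|` \bigcup_(X in F) X : set {classic T}).
  by rewrite -As.
rewrite As {A finA As}; elim: s => [|a s IH] sF; first by left.
have sF' : [set` s] `<=` (G `|` \bigcup_(X in F) X : set {classic T}).
  by move=> y sy; apply: sF; rewrite /= inE (_ : y \in s) ?orbT.
have consP (B : set {classic T}) :
    B a -> [set` s] `<=` B -> [set` a :: s] `<=` B.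
  by move=> Ba sB y; rewrite /= inE => /predU1P[->|/sB].
have [Ga|[X FX Xa]] := sF a (mem_head a s); case: (IH sF') => [sG|[Y FY sY]].
- by left; apply: consP.
- by right; exists Y => //; apply: consP => //; left.
- right; exists X => //; apply: consP; first by right.
  by move=> y /sG; left.
- have [XY|YX] := totF _ _ FX FY.
    by right; exists Y => //; apply: consP => //; right; apply: XY.
  right; exists X => //; apply: consP; first by right.
  by move=> y /sY[]; [left | move=> /YX; right].
Qed.

(** * Residuation in FL-algebras *)

Section Residuated.
Context (d : Order.disp_t) (A : flAlgType d).
Implicit Types x y z : A.

Lemma le1_ldiv x y : (1%g <= ldiv x y) = (x <= y).
Proof. by rewrite le_ldiv monoid.mulg1. Qed.

Lemma le1_rdiv x y : (1%g <= rdiv y x) = (x <= y).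
Proof. by rewrite le_rdiv monoid.mul1g. Qed.

Lemma le_mulg2l z x y : x <= y -> (z * x)%g <= (z * y)%g.
Proof. by move=> xy; rewrite -le_ldiv (le_trans xy) // le_ldiv. Qed.

Lemma le_mulg2r z x y : x <= y -> (x * z)%g <= (y * z)%g.
Proof. by move=> xy; rewrite -le_rdiv (le_trans xy) // le_rdiv. Qed.

Lemma le_mulg x1 y1 x2 y2 :
  x1 <= y1 -> x2 <= y2 -> (x1 * x2)%g <= (y1 * y2)%g.
Proof.
by move=> le1 le2; apply: le_trans (le_mulg2r x2 le1) (le_mulg2l y1 le2).
Qed.

Lemma mul0g x : (\bot * x)%g = \bot :> A.
Proof. by apply/eqP; rewrite -lex0 -le_rdiv le0x. Qed.

Lemma mulg0 x : (x * \bot)%g = \bot :> A.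
Proof. by apply/eqP; rewrite -lex0 -le_ldiv le0x. Qed.

Lemma le_rdivl x y : x <= rdiv y (ldiv x y).
Proof. by rewrite le_rdiv -le_ldiv. Qed.

Lemma le_ldivr x y : x <= ldiv (rdiv y x) y.
Proof. by rewrite le_ldiv -le_rdiv. Qed.

(** Triple negation law of the antitone Galois connection formed by the two divisions into [y]; the
    two sides must alternate. *)
Lemma rdiv_ldiv_rdiv x y : rdiv y (ldiv (rdiv y x) y) <= rdiv y x.
Proof.
set w := rdiv y (ldiv _ y).
rewrite le_rdiv (@le_trans _ _ (w * ldiv (rdiv y x) y)%g) //.
  by apply: le_mulg2l; apply: le_ldivr.
by rewrite -le_rdiv.
Qed.

Lemma ldiv_rdiv_ldiv x y : ldiv (rdiv y (ldiv x y)) y <= ldiv x y.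
Proof.
set w := ldiv (rdiv y _) y.
rewrite le_ldiv (@le_trans _ _ (rdiv y (ldiv x y) * w)%g) //.
  by apply: le_mulg2r; apply: le_rdivl.
by rewrite -le_ldiv.
Qed.

End Residuated.

(** * Negation in the two-element algebra *)

Section Classical.
Context (V : Type).
Implicit Types (G : set (form V)) (x y : form V) (h : form V -> bool).

Lemma hom_lnegb h x : is_hom h -> h (lneg x) = ~~ h x.
Proof. by move=> hh; rewrite (hom_ldiv hh) (hom_zero hh); case: (h x). Qed.

Lemma hom_rnegb h x : is_hom h -> h (rneg x) = ~~ h x.
Proof. by move=> hh; rewrite (hom_rdiv hh) (hom_zero hh); case: (h x). Qed.

Lemma CL_sem_equiv x y : (forall h, is_hom h -> h x = h y) ->
  forall G, CL G x <-> CL G y.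
Proof.
by move=> xy G; split=> Gx h hh /(Gx h hh); rewrite xy.
Qed.

Lemma CL_rneg G x : CL G (rneg x) <-> CL G (lneg x).
Proof. by apply: CL_sem_equiv => h hh; rewrite hom_lnegb ?hom_rnegb. Qed.

Lemma CL_lneg2 G x : CL G (lneg (lneg x)) <-> CL G x.
Proof. by apply: CL_sem_equiv => h hh; rewrite !hom_lnegb ?negbK. Qed.

Lemma CL_rneg2 G x : CL G (rneg (rneg x)) <-> CL G x.
Proof. by apply: CL_sem_equiv => h hh; rewrite !hom_rnegb ?negbK. Qed.

Lemma CL_deduction G x : CL (G `|` [set x]) Zero -> CL G (lneg x).
Proof.
move=> Gx h hh hG; rewrite hom_lnegb //; apply/negP => hx.
suff : h Zero = true by rewrite (hom_zero hh).
by apply: Gx => // g [/hG|->].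
Qed.

End Classical.

(** * Derivability in [L] from inequalities in FL-algebras *)

Section Logic.
Context (V : Type) (L : consequence V).
Hypotheses (L_logic : is_logic L) (FL_le_L : logic_le (@FL V) L).
Implicit Types (G D M : set (form V)) (x y z : form V).

(** Equality as conclusions only: replacement under a negation is not built in and will require
    [deduction]. *)
Definition interderivable x y := forall G, L G x <-> L G y.

(* [deduction] and [glivenko_axiom] are the two halves of condition (5), the
   second one closed under substitution and weakening. *)
Definition deduction :=
  forall G x, L (G `|` [set x]) Zero <-> L G (lneg x).

Definition glivenko_axiom := forall G x y,
  L G (lneg (Meet x (lneg y))) -> L G (lneg (lneg (Ldiv x y))).

Lemma L_cut G D x : (forall y, D y -> L G y) -> L D x -> L G x.
Proof.
move=> GD Dx; apply: (logic_cut L_logic) GD _.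
by apply: (logic_mono L_logic) Dx => y; right.
Qed.

Lemma L_cut1 G x y : L [set x] y -> L G x -> L G y.
Proof. by move=> xy Gx; apply: L_cut xy => z ->. Qed.

Lemma L_axiom G x :
  (forall d (A : flAlgType d) (h : form V -> A), is_hom h -> 1%g <= h x) ->
  L G x.
Proof. by move=> vx; apply: FL_le_L => d A h hh _; apply: vx. Qed.

(** An implication between inequalities [1 <= _] in all FL-algebras is a rule of FL, hence of [L] by
    cut. *)
Lemma L_rule1 G x y :
  (forall d (A : flAlgType d) (h : form V -> A), is_hom h ->
    1%g <= h x -> 1%g <= h y) -> L G x -> L G y.
Proof.
move=> xy; apply: L_cut1; apply: FL_le_L => d A h hh hx.
by apply: xy => //; apply: hx.
Qed.

Lemma L_rule2 G x y z :
  (forall d (A : flAlgType d) (h : form V -> A), is_hom h ->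
    1%g <= h x -> 1%g <= h y -> 1%g <= h z) -> L G x -> L G y -> L G z.
Proof.
move=> xyz Gx Gy; apply: (@L_cut _ [set x; y]); first by move=> w [->|->].
apply: FL_le_L => d A h hh hxy.
by apply: xyz => //; apply: hxy; [left | right].
Qed.

Lemma ldiv_rdiv_interderivable x y : interderivable (Ldiv x y) (Rdiv y x).
Proof.
by move=> G; split; apply: L_rule1 => d A h hh;
  rewrite (hom_ldiv hh) (hom_rdiv hh) le1_ldiv le1_rdiv.
Qed.

Lemma lneg_rneg_interderivable x : interderivable (lneg x) (rneg x).
Proof. exact: ldiv_rdiv_interderivable. Qed.

Lemma lneg_elim G x : L G (lneg x) -> L G x -> L G Zero.
Proof.
apply: L_rule2 => d A h hh; rewrite (hom_ldiv hh) le1_ldiv => + hx.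
exact: le_trans.
Qed.

Lemma rneg3 G x : L G (rneg (lneg (rneg x))) -> L G (rneg x).
Proof.
apply: L_rule1 => d A h hh.
rewrite !(hom_rdiv hh, hom_ldiv hh) => /le_trans; apply; exact: rdiv_ldiv_rdiv.
Qed.

Lemma lneg3 G x : L G (lneg (rneg (lneg x))) -> L G (lneg x).
Proof.
apply: L_rule1 => d A h hh.
rewrite !(hom_rdiv hh, hom_ldiv hh) => /le_trans; apply; exact: ldiv_rdiv_ldiv.
Qed.

Lemma L_meet G x y : L G (Meet x y) <-> L G x /\ L G y.
Proof.
split=> [Gxy|[]]; last first.
  by apply: L_rule2 => d A h hh hx hy; rewrite (hom_meet hh) lexI hx.
by split; apply: L_rule1 Gxy => d A h hh;
  rewrite (hom_meet hh) lexI => /andP[].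
Qed.

Lemma L_bot G x : L G Bot -> L G x.
Proof.
apply: L_rule1 => d A h hh; rewrite (hom_bot hh) lex0 => /eqP bot1.
by rewrite bot1 le0x.
Qed.

Lemma meet_interderivable x y y' :
  interderivable y y' -> interderivable (Meet x y) (Meet x y').
Proof. by move=> yy' G; rewrite !L_meet yy'. Qed.

Lemma interderivable_trans y x z :
  interderivable x y -> interderivable y z -> interderivable x z.
Proof. by move=> xy yz G; rewrite xy. Qed.

Lemma interderivable_sym x y : interderivable x y -> interderivable y x.
Proof. by move=> xy G; rewrite xy. Qed.

Lemma L_interderivable x x' y y' :
  interderivable x x' -> interderivable y y' ->
  L [set x] y <-> L [set x'] y'.
Proof.
move=> xx' yy'; rewrite (yy' _); split; apply: L_cut => z ->; apply/xx';
  exact: (logic_refl L_logic).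
Qed.

Lemma L_extend_interderivable G x y z :
  interderivable x y -> L (G `|` [set x]) z <-> L (G `|` [set y]) z.
Proof.
have H u w : interderivable u w -> L (G `|` [set u]) z -> L (G `|` [set w]) z.
  move=> uw; apply: L_cut => v [Gv|->].
    by apply: (logic_refl L_logic); left.
  by apply/uw; apply: (logic_refl L_logic); right.
by move=> xy; split; apply: H => //; apply: interderivable_sym.
Qed.

(** * Exchanging left and right negations *)

Lemma deduction_rneg :
  deduction <-> (forall G x, L (G `|` [set x]) Zero <-> L G (rneg x)).
Proof.
split=> ded G x; rewrite ded; first exact: lneg_rneg_interderivable.
exact/interderivable_sym/lneg_rneg_interderivable.
Qed.

(** Deduction turns the negated formula into a premise, and interderivable premises can be exchanged
    by cut. *)
Lemma lneg_interderivable x y :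
  deduction -> interderivable x y -> interderivable (lneg x) (lneg y).
Proof. by move=> ded xy G; rewrite -!ded; apply: L_extend_interderivable. Qed.

Lemma neg2_interderivable x y : deduction -> interderivable x y ->
  interderivable (lneg (lneg x)) (rneg (rneg y)).
Proof.
move=> ded xy; apply: interderivable_trans (lneg_rneg_interderivable _).
apply: lneg_interderivable => //.
apply: interderivable_trans (lneg_rneg_interderivable _).
exact: lneg_interderivable.
Qed.

Lemma glivenko_axiom_rneg x y : deduction ->
  L [set lneg (Meet x (lneg y))] (lneg (lneg (Ldiv x y))) <->
  L [set rneg (Meet x (rneg y))] (rneg (rneg (Rdiv y x))).
Proof.
move=> ded; apply: L_interderivable.
  apply: interderivable_trans (lneg_rneg_interderivable _).
  apply: lneg_interderivable => //; apply: meet_interderivable.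
  exact: lneg_rneg_interderivable.
exact/neg2_interderivable/ldiv_rdiv_interderivable.
Qed.

Lemma glivenko_axiom_subst (p q : V) : p <> q ->
  L [set lneg (Meet (Var p) (lneg (Var q)))]
    (lneg (lneg (Ldiv (Var p) (Var q)))) -> glivenko_axiom.
Proof.
(* Only [p] and [q] occur in the axiom, so the value at other variables is irrelevant. *)
move=> pq Lpq G x y; pose s v := if `[< v = p >] then x else y.
have sp : s p = x by rewrite /s; case: asboolP.
have sq : s q = y by rewrite /s; case: asboolP => // /esym.
have := logic_struct L_logic s Lpq; rewrite image_set1 /= sp sq.
exact: L_cut1.
Qed.

(** * Lindenbaum extension and the Glivenko property *)

Section Completeness.
Hypotheses (L_compact : compact_logic L).
Hypotheses (ded : deduction) (gliv : glivenko_axiom).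

(** Instance of the axiom at [Bot]: its premise follows from [lneg x] because a meet with [x] lies
    below [x]. *)
Lemma lneg_ldiv_bot G x : L G (lneg x) -> L G (lneg (lneg (Ldiv x Bot))).
Proof.
move=> Gx; apply: gliv; apply: L_rule1 Gx => d A h hh.
by rewrite !(hom_ldiv hh) !le1_ldiv (hom_meet hh); apply: le_trans (leIl _ _).
Qed.

(* Compactness speaks about sets proving every formula, whereas [0] need not
   prove anything; adding [0 \ bot], which is doubly negated provable, makes
   the sets proving [0] inconsistent. *)
Lemma Zero_compact G : L G Zero ->
  exists G', [/\ finite_set G', G' `<=` G & L G' Zero].
Proof.
move=> GZ; pose e : form V := Ldiv Zero Bot.
have [x|G' [fG' G'Ge G'L]] := @L_compact (G `|` [set e]).
  apply: L_bot; apply: (@L_rule2 _ e Zero) => [d A h hh||].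
  - by rewrite (hom_ldiv hh) le1_ldiv => + hx; apply: le_trans.
  - by apply: (logic_refl L_logic); right.
  - by apply: (logic_mono L_logic) GZ => y; left.
(* The intersection discards [e] unless it is in [G]; deduction then yields [lneg e], against
   [lneg (lneg e)]. *)
exists (G' `&` G); split; [exact: finite_setIl | by move=> y [] |].
apply: (@lneg_elim _ (lneg e)).
  apply: lneg_ldiv_bot; apply: L_axiom => d A h hh.
  by rewrite (hom_ldiv hh) le1_ldiv.
apply/ded; apply: (logic_mono L_logic) (G'L Zero) => y G'y.
by have [Gy|->] := G'Ge _ G'y; [left | right].
Qed.

Lemma lindenbaum G : ~ L G Zero -> exists M,
  [/\ G `<=` M, ~ L M Zero & forall x, M x \/ L (M `|` [set x]) Zero].
Proof.
move=> GZ.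
(* Zorn is applied to the sets added to [G], not to supersets of [G], so that the empty union is
   admissible. *)
have [F FZ totF|D [DZ Dmax]] := @Zorn_bigcup _ [set D | ~ L (G `|` D) Zero].
  move=> /Zero_compact[G' [fG' G'F G'Z]].
  have [G'G|[X FX G'X]] := finite_sub_chain totF fG' G'F.
    by apply: GZ; apply: (logic_mono L_logic) G'Z.
  by apply: FZ FX _; apply: (logic_mono L_logic) G'Z.
exists (G `|` D); split=> [y Gy||x]; [by left | by [] |].
have [|Mx] := pselect ((G `|` D) x); [by left | right].
rewrite -setUA; apply: contrapT; apply: Dmax.
split=> [y|sub]; [by left | apply: Mx; right; apply: sub; by right].
Qed.

(** * Maximal sets as Boolean valuations *)

Section MaximalSet.
Context (M : set (form V)) (MZ : ~ L M Zero).
Hypothesis M_max : forall x, M x \/ L (M `|` [set x]) Zero.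

(** Maximality and deduction give the negation of a missing formula; consistency gives the
    converse. *)
Lemma maximal_neg x : ~ M x <-> L M (lneg x).
Proof.
split=> [Mx|Mnx Mx]; first by have [//|/ded] := M_max x.
by apply: MZ; apply: (lneg_elim Mnx); apply: (logic_refl L_logic).
Qed.

Lemma maximal_closed x : M x <-> L M x.
Proof.
split=> [|Lx]; first exact: (logic_refl L_logic).
by apply: contrapT => /maximal_neg /lneg_elim /(_ Lx).
Qed.

Lemma maximal_lneg2 x : L M (lneg (lneg x)) -> M x.
Proof.
by move=> /maximal_neg nMnx; apply: contrapT => /maximal_neg/maximal_closed.
Qed.

Lemma maximal_ldiv x y : M (Ldiv x y) <-> (M x -> M y).
Proof.
split=> [/maximal_closed Mxy /maximal_closed Mx|Mxy].
  apply/maximal_closed; apply: L_rule2 Mxy Mx => d A h hh.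
  by rewrite (hom_ldiv hh) le1_ldiv => + hx; apply: le_trans.
apply: maximal_lneg2; apply: gliv; apply/maximal_neg.
by move=> /maximal_closed /L_meet[/maximal_closed/Mxy ? /maximal_neg].
Qed.

Lemma maximal_rdiv x y : M (Rdiv y x) <-> (M x -> M y).
Proof.
rewrite -maximal_ldiv !maximal_closed.
exact/interderivable_sym/ldiv_rdiv_interderivable.
Qed.

Lemma maximal_bot : ~ M Bot.
Proof. by move=> /maximal_closed /(@L_bot _ Zero). Qed.

(** Without weakening, a product need not lie below its factors. But a factor outside [M] is below
    [Bot] according to [M], and [Bot] absorbs products, so the product would put [Bot] in [M]. *)
Lemma maximal_mul x y : M (Mul x y) <-> M x /\ M y.
Proof.
split=> [/maximal_closed Mxy|[/maximal_closed Mx /maximal_closed My]].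
  split; apply: contrapT => nM; apply: maximal_bot; apply/maximal_closed.
    have /maximal_closed : M (Ldiv x Bot) by apply/maximal_ldiv.
    apply: L_rule2 Mxy => d A h hh.
    rewrite (hom_mul hh) (hom_ldiv hh) le1_ldiv (hom_bot hh) => h1 hx.
    by apply: le_trans h1 _; rewrite -(mul0g (h y)) le_mulg2r.
  have /maximal_closed : M (Ldiv y Bot) by apply/maximal_ldiv.
  apply: L_rule2 Mxy => d A h hh.
  rewrite (hom_mul hh) (hom_ldiv hh) le1_ldiv (hom_bot hh) => h1 hy.
  by apply: le_trans h1 _; rewrite -(mulg0 (h x)) le_mulg2l.
apply/maximal_closed; apply: L_rule2 Mx My => d A h hh hx hy.
by rewrite (hom_mul hh) -[leLHS](monoid.mulg1 1%g) le_mulg.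
Qed.

(** If both disjuncts were refuted, both would lie below 0, and so would their join. *)
Lemma maximal_join x y : M (Join x y) <-> M x \/ M y.
Proof.
split=> [/maximal_closed Mxy|[]/maximal_closed]; last first.
- by move=> My; apply/maximal_closed; apply: L_rule1 My => d A h hh hy;
    rewrite (hom_join hh) (le_trans hy) ?leUr.
- by move=> Mx; apply/maximal_closed; apply: L_rule1 Mx => d A h hh hx;
    rewrite (hom_join hh) (le_trans hx) ?leUl.
have [|/maximal_neg nx] := pselect (M x); [by left | right].
apply: contrapT => /maximal_neg ny; apply: MZ; apply: lneg_elim Mxy.
apply: L_rule2 nx ny => d A h hh.
by rewrite !(hom_ldiv hh) !le1_ldiv (hom_join hh) leUx => -> ->.
Qed.

Lemma maximal_hom : is_hom (fun x => `[< M x >]).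
Proof.
have topM x : (forall d (A : flAlgType d) (h : form V -> A), is_hom h ->
    1%g <= h x) -> `[< M x >] = true.
  by move=> vx; apply/asboolT/maximal_closed/L_axiom.
split=> [x y|x y|||x y||x y|x y|].
(* The operations of the algebra [bool] unfold to the Boolean connectives. *)
- change (`[< M (Meet x y) >] = `[< M x >] && `[< M y >]).
  rewrite -asbool_and; apply: asbool_equiv_eq.
  by rewrite !maximal_closed L_meet.
- change (`[< M (Join x y) >] = `[< M x >] || `[< M y >]).
  rewrite -asbool_or; apply: asbool_equiv_eq; exact: maximal_join.
- by apply: topM => d A h hh; rewrite (hom_top hh) lex1.
- exact/asboolF/maximal_bot.
- change (`[< M (Mul x y) >] = `[< M x >] && `[< M y >]).
  rewrite -asbool_and; apply: asbool_equiv_eq; exact: maximal_mul.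
- by apply: topM => d A h hh; rewrite (hom_one hh).
- change (`[< M (Ldiv x y) >] = (`[< M x >] ==> `[< M y >])).
  rewrite -asbool_imply; apply: asbool_equiv_eq; exact: maximal_ldiv.
- change (`[< M (Rdiv x y) >] = (`[< M y >] ==> `[< M x >])).
  rewrite -asbool_imply; apply: asbool_equiv_eq; exact: maximal_rdiv.
- by apply/asboolF => /maximal_closed.
Qed.

End MaximalSet.

Lemma glivenko G x : CL G x -> L G (lneg (lneg x)).
Proof.
move=> Gx; apply/ded; apply: contrapT => /lindenbaum[M [GM MZ M_max]].
have Mnx : L M (lneg x) by apply: (logic_refl L_logic); apply: GM; right.
apply: (iffRL (maximal_neg MZ M_max x) Mnx).
have /asboolP // : `[< M x >] = true.
apply: (Gx _ (maximal_hom MZ M_max)) => g Gg.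
by apply/asboolT; apply: GM; left.
Qed.

End Completeness.

(** * Consequences of agreement with [CL] on negations *)

Section NegationTransfer.
Hypotheses (L_le_CL : logic_le L (@CL V)).
Hypotheses (lnegP : forall G x, CL G (lneg x) <-> L G (lneg x)).

Lemma deduction_of_lneg : deduction.
Proof.
move=> G x; split=> [/L_le_CL/CL_deduction/lnegP //|Gx].
apply: (@lneg_elim _ x); last by apply: (logic_refl L_logic); right.
by apply: (logic_mono L_logic) Gx => y; left.
Qed.

(** Premise and conclusion are classically equivalent, and both are negations, so the equivalence
    passes to [L]. *)
Lemma glivenko_axiom_of_lneg : glivenko_axiom.
Proof.
move=> G x y /lnegP Gxy; apply/lnegP; move: Gxy; apply: iffLR.
apply: CL_sem_equiv => h hh.
rewrite !hom_lnegb // (hom_meet hh) (hom_ldiv hh) hom_lnegb //.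
by case: (h x); case: (h y).
Qed.

End NegationTransfer.

End Logic.

Theorem theorem4p32 (V : Type) (V_infinite : infinite_set [set: V])
    (p q : V) (p_neq_q : p <> q) (L : consequence V)
    (L_logic : is_logic L) (L_compact : compact_logic L)
    (FL_le_L : logic_le (@FL V) L) (L_le_CL : logic_le L (@CL V)) :
  [<-> forall (G : set (form V)) (x : form V),
         CL G x <-> L G (lneg (lneg x));
       forall (G : set (form V)) (x : form V),
         CL G x <-> L G (rneg (rneg x));
       forall (G : set (form V)) (x : form V),
         CL G (lneg x) <-> L G (lneg x);
       forall (G : set (form V)) (x : form V),
         CL G (rneg x) <-> L G (rneg x);
       (forall (G : set (form V)) (x : form V),
         L (G `|` [set x]) Zero <-> L G (lneg x)) /\
       L [set lneg (Meet (Var p) (lneg (Var q)))]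
         (lneg (lneg (Ldiv (Var p) (Var q))));
       (forall (G : set (form V)) (x : form V),
         L (G `|` [set x]) Zero <-> L G (rneg x)) /\
       L [set rneg (Meet (Var p) (rneg (Var q)))]
         (rneg (rneg (Rdiv (Var q) (Var p))))].
Proof.
have neg := lneg_rneg_interderivable L_logic FL_le_L.
have lneg_ded := deduction_of_lneg L_logic FL_le_L L_le_CL.
have rneg_lneg : (forall G x, CL G (rneg x) <-> L G (rneg x)) ->
    forall G x, CL G (lneg x) <-> L G (lneg x).
  by move=> H G x; rewrite -CL_rneg H neg.
tfae.
- move=> H G x; split=> [|/L_le_CL/CL_rneg2 //].
  (* The hypothesis at [rneg (rneg x)] adds two left negations; making the outermost one right gives
     an alternating triple, which collapses. *)
  by move=> /CL_rneg2/H/neg/(rneg3 L_logic FL_le_L).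
- move=> H G x; split=> [|/L_le_CL //].
  (* Likewise [rneg (rneg (lneg x))] becomes an alternating triple once its outermost negation is
     made left. *)
  by move=> /H ?; apply: (lneg3 L_logic FL_le_L); apply/neg.
- by move=> H G x; rewrite CL_rneg H neg.
- move=> /rneg_lneg H; split; first exact: lneg_ded.
  apply: (glivenko_axiom_of_lneg H); exact: (logic_refl L_logic).
- move=> [ded Hpq]; split; first exact/deduction_rneg.
  exact/(glivenko_axiom_rneg L_logic FL_le_L).
(* The right-hand condition is first turned into the left-hand one, for which the completeness
   argument is stated. *)
- move=> [/(deduction_rneg L_logic FL_le_L) ded].
  move=> /(glivenko_axiom_rneg L_logic FL_le_L _ _ ded).
  move=> /(glivenko_axiom_subst L_logic p_neq_q) gliv G x.
  split=> [|/L_le_CL/CL_lneg2 //]; exact: glivenko.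
Qed.
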